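(* For every positive integer $k$ there exists $\varepsilon=\varepsilon_k>0$ such that for infinitely many integers $n$ there exists a $3$-graph $H$ with vertex partition $V(H)=A\cup B$, $|A|=|B|=n$, such that every edge of $H$ has exactly two vertices in $A$ and one in $B$, and: (C1) $d_H(\{a_1,a_2\})\ge\varepsilon n$ for any two distinct vertices $a_1,a_2\in A$; (C2) $d_H(\{a,b\})\ge\varepsilon n$ for every $a\in A$ and $b\in B$; (C3) $H$ contains no copy of any $3$-graph $F$ with $|V(F)|\le k$ and $\pi_{\text{unif}}(F)>0$.
   Context: A $3$-graph is a $3$-uniform hypergraph. For a $2$-subset $S\subseteq V(H)$, $d_H(S)$ is the number of edges of $H$ containing $S$. For $d\in[0,1]$ and $\eta>0$, an $n$-vertex $3$-graph $H$ is uniformly $(d,\eta)$-dense if for all $U\subseteq V(H)$, $|\binom{U}{3}\cap E(H)|\ge d\binom{|U|}{3}-\eta n^3$. The uniform Turán density $\pi_{\text{unif}}(F)$ is the supremum of all $d\in[0,1]$ such that for every $\eta>0$ and $n_0\in\mathbb{N}$ there exists an $F$-free uniformly $(d,\eta)$-dense $3$-graph $H$ with $|V(H)|\ge n_0$. A copy of $F$ in $H$ means a (not necessarily induced) subhypergraph of $H$ isomorphic to $F$. *)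

(* Defs.v *)
From mathcomp Require Import all_boot all_order all_algebra.
From mathcomp Require Import classical_sets reals.
Set Implicit Arguments. Unset Strict Implicit. Unset Printing Implicit Defensive.
Import Order.TTheory GRing.Theory Num.Theory.
Local Open Scope ring_scope.

Definition is3graph (V : finType) (E : {set {set V}}) : bool :=
  [forall e in E, #|e| == 3]%N.

Definition codeg (V : finType) (E : {set {set V}}) (S : {set V}) : nat :=
  #|[set e in E | S \subset e]|.

Definition has_copy (W V : finType) (EF : {set {set W}}) (E : {set {set V}}) : Prop :=
  exists f : W -> V, injective f /\ forall e, e \in EF -> f @: e \in E.

Definition unif_dense (R : realType) (V : finType) (d eta : R) (E : {set {set V}}) : Prop :=
  forall U : {set V},
    (#|[set e in E | e \subset U]|%:R : R) >= d * ('C(#|U|, 3))%:R - eta * (#|V|%:R) ^+ 3.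

Definition pi_unif (R : realType) (W : finType) (EF : {set {set W}}) : R :=
  sup [set d : R | 0 <= d <= 1 /\
        forall (eta : R), 0 < eta -> forall n0 : nat,
          exists N : nat, (n0 <= N)%N /\
            exists E : {set {set 'I_N}},
              is3graph E /\ ~ has_copy EF E /\ unif_dense d eta E].

Definition partA (n : nat) : {set ('I_n + 'I_n)%type} :=
  [set x | if x is inl _ then true else false].
Definition partB (n : nat) : {set ('I_n + 'I_n)%type} :=
  [set x | if x is inr _ then true else false].

(* Main.v *)
Require Import Defs.
From mathcomp Require Import boolp classical_sets reals.
From mathcomp Require Import all_boot all_order all_algebra.
From mathcomp Require Import zify ring lra.
Set Implicit Arguments. Unset Strict Implicit. Unset Printing Implicit Defensive.
Import Order.TTheory GRing.Theory Num.Theory.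

(** Both parts consist of [2 ^ k] blocks, indexed by the vectors of ['F_2 ^ k].  For most
    [b] in [B] the link of [b] is a union of complete bipartite graphs between the blocks
    [i] and [i + c], with [c] depending on [b]; for the other [b] a balanced Hadamard cut
    depending on [b] directs the link from one side to the other, along the order inside
    the blocks and from each block to its cyclic successor.  A subhypergraph [F] on at most
    [k] vertices misses a block, and cutting the cyclic order there orders the vertices of
    [F] in [A] in such a way that in the link of each [b] every vertex is a source or a
    sink.

    Such an [F] has vanishing uniform Turan density, by an argument avoiding hypergraph
    regularity.  Choose [d] just below the supremum: a dense [F]-free 3-graph that is not
    uniformly [(d + e)]-dense contains a set [U] of density about [d] that is uniformly
    [d]-dense.  Comparing [U] with [U :\: A] then shows that pairs inside any large [A]
    have on average codegree proportional to [#|U|], so a greedy choice gives arbitrarily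
    many vertices with all pairwise codegrees at least [#|U| / q], where [q] does not
    depend on their number.  By Ramsey's theorem, among sufficiently many such vertices
    there are [v_1], ..., [v_k] such that for every set [S] many [b] lie in the
    neighbourhoods of all the pairs [v_i], [v_j] with [i < j], [v_i] in [S] and [v_j]
    outside [S]; this suffices to embed [F]. *)

(** * Ramsey's theorem and shattering *)

Section EndHomogeneous.
Variables (T : eqType) (k : nat) (P : pred (seq T)).

(** The colour of a [k.+1]-subsequence depends on its first element only: the intermediate stage in
    the Erdos-Rado proof of Ramsey's theorem. *)
Fixpoint end_homogeneous (t : seq T) : Prop :=
  if t is x :: t' then
    (exists c, forall u, subseq u t' -> size u = k -> P (x :: u) = c)
    /\ end_homogeneous t'
  else True.

Lemma end_homogeneous_split (t : seq T) : end_homogeneous t ->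
  exists t0 t1 : seq T,
    [/\ subseq t0 t, subseq t1 t, size t <= size t0 + size t1,
        (forall u, subseq u t0 -> size u = k.+1 -> P u = false) &
        (forall u, subseq u t1 -> size u = k.+1 -> P u = true)].
Proof.
elim: t => [|x t IH] /=.
  by move=> _; exists [::], [::]; split=> // u; rewrite subseq0 => /eqP->.
case=> -[c Pc] /IH [t0 [t1 [s0 s1 sz P0 P1]]].
have ext b t' : (forall u, subseq u t' -> size u = k.+1 -> P u = b) ->
    subseq t' t -> c = b ->
    forall u, subseq u (x :: t') -> size u = k.+1 -> P u = b.
  move=> Pb st' cb [|y u] //=; case: eqP => [-> su [szu]|_ su szu].
    by rewrite -cb; apply: Pc => //; apply: subseq_trans st'.
  exact: Pb.
case: c Pc ext => Pc ext.
- exists t0, (x :: t1); split=> //=; rewrite ?eqxx ?addnS //.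
    by apply: subseq_trans (subseq_cons t x).
  exact: (ext true).
exists (x :: t0), t1; split=> //=; rewrite ?eqxx //.
  by apply: subseq_trans (subseq_cons t x).
exact: (ext false).
Qed.

End EndHomogeneous.

(** Induction on [k]: keep the head [x], pass to a part of the tail homogeneous for [u] coloured by
    [P (x :: u)], and repeat. Of the [m + m] elements kept, some [m] carry the same colour. *)
Lemma ramsey (k m : nat) : exists M, forall (T : eqType) (P : pred (seq T)) s,
  M <= size s -> exists t, [/\ subseq t s, size t = m &
    exists c, forall u, subseq u t -> size u = k -> P u = c].
Proof.
elim: k m => [|k IH] m.
  exists m => T P s ms; exists (take m s); split.
  - exact: take_subseq.
  - by rewrite size_takel.
  by exists (P [::]) => u _ /size0nil->.
have [M HM] : exists M, forall (T : eqType) (P : pred (seq T)) s,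
    M <= size s -> exists t, [/\ subseq t s, size t = m + m &
      end_homogeneous k P t].
  elim: (m + m) => [|n [M HM]].
    by exists 0 => T P s _; exists [::]; rewrite sub0seq.
  have [M' HM'] := IH M.
  exists M'.+1 => T P [//|x s] /= szs.
  have [t [ts szt Pt]] := HM' _ (fun u => P (x :: u)) s szs.
  have [|t' [ts' szt' Pt']] := HM _ P t; first by rewrite szt.
  exists (x :: t'); rewrite /= eqxx szt' (subseq_trans ts' ts); split=> //.
  split=> //; case: Pt => c Pc; exists c => u ut; apply: Pc.
  exact: subseq_trans ts'.
exists M => T P s /HM -/(_ P) [t [ts szt]] /end_homogeneous_split.
case=> t0 [t1 [s0 s1 sz P0 P1]].
have [le_m|lt_m] := leqP m (size t1).
  exists (take m t1); rewrite size_takel //; split=> //.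
    exact: subseq_trans (take_subseq _ _) (subseq_trans s1 ts).
  by exists true => u us; apply: P1; exact: subseq_trans us (take_subseq _ _).
exists (take m t0); rewrite size_takel; last by lia.
split=> //.
  exact: subseq_trans (take_subseq _ _) (subseq_trans s0 ts).
by exists false => u us; apply: P0; exact: subseq_trans us (take_subseq _ _).
Qed.

(** Ramsey's theorem makes the predicates constant one after another; a constant predicate that
    occurs in every subsequence of length at least [L] is true throughout. *)
Lemma ramsey_unavoidable (r k L m : nat) :
  exists M, forall (I : finType) (T : eqType) (P : I -> pred (seq T)) s,
    #|I| <= r ->
    (forall i t, subseq t s -> L <= size t ->
       exists u, [/\ subseq u t, size u = k & P i u]) ->
    M <= size s ->
    exists t, [/\ subseq t s, size t = m &
      forall i u, subseq u t -> size u = k -> P i u].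
Proof.
suff [M HM] : exists M, forall (I : finType) (T : eqType) (P : I -> pred (seq T)) s
    (A : seq I), size A <= r ->
    (forall i t, subseq t s -> L <= size t ->
       exists u, [/\ subseq u t, size u = k & P i u]) ->
    M <= size s ->
    exists t, [/\ subseq t s, size t = m &
      forall i, i \in A -> forall u, subseq u t -> size u = k -> P i u].
  exists M => I T P s Ir Hs Ms.
  have [|t [ts szt Pt]] := HM _ _ P s (enum I) _ Hs Ms; first by rewrite -cardE.
  by exists t; split=> // i u; apply: Pt; rewrite mem_enum.
elim: r => [|r [M HM]].
  exists m => I T P s [] // _ _ ms; exists (take m s).
  by rewrite take_subseq size_takel.
have [M' HM'] := ramsey k (maxn M L).
exists M' => I T P s [|i A] szA Hs Ms.
  have [t [ts szt Pt]] := HM' _ (fun=> true) s Ms.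
  have [||t' [ts' szt' Pt']] := HM _ _ P t [::] isT.
  - by move=> i t' ts'; apply: Hs; apply: subseq_trans ts.
  - by rewrite szt leq_maxl.
  by exists t'; split=> //; apply: subseq_trans ts.
have [t [ts szt [c Pc]]] := HM' _ (P i) s Ms.
have c_true : c = true.
  have [|u [ut szu Pu]] := Hs i t ts; first by rewrite szt leq_maxr.
  by rewrite -(Pc u ut szu).
have [||t' [ts' szt' Pt']] := HM _ _ P t A szA.
- by move=> j t' ts'; apply: Hs; apply: subseq_trans ts.
- by rewrite szt leq_maxl.
exists t'; split=> //; first exact: subseq_trans ts.
move=> j; rewrite inE => /orP[/eqP-> u ut szu|]; last exact: Pt'.
by rewrite (Pc u) //; apply: subseq_trans ts'.
Qed.

Lemma card_capU_le (V : finType) (c : nat) (X : {set V}) (l : seq {set V}) :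
  all (fun Y => #|X :&: Y| <= c) l -> #|X :&: \bigcup_(Y <- l) Y| <= c * size l.
Proof.
elim: l => [|Y l IH] /=; first by rewrite big_nil setI0 cards0.
case/andP=> cY /IH cl; rewrite big_cons setIUr mulnS.
by apply: leq_trans (leq_add cY cl); rewrite cardsU leq_subr.
Qed.

Lemma sum_card_le_bigcup (V : finType) (c : nat) (l : seq {set V}) :
  pairwise (fun X Y : {set V} => #|X :&: Y| <= c) l ->
  \sum_(X <- l) #|X| <= #|\bigcup_(X <- l) X| + c * size l ^ 2.
Proof.
elim: l => [|X l IH] /=; first by rewrite !big_nil cards0.
case/andP=> /card_capU_le cX /IH cl; rewrite !big_cons.
have := cardsUI X (\bigcup_(Y <- l) Y).
have : c * size l + c * size l ^ 2 <= c * (size l).+1 ^ 2.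
  by rewrite -mulnDr leq_mul2l; apply/orP; right; nia.
lia.
Qed.

Lemma not_pairwise (T : eqType) (r : rel T) (s : seq T) :
  ~~ pairwise r s -> exists x y, subseq [:: x; y] s /\ ~~ r x y.
Proof.
elim: s => [|x s IH] //=; rewrite negb_and => /orP[|/IH].
  by case/allPn=> y ys nrxy; exists x, y; rewrite eqxx sub1seq.
case=> a [b [abs nr]]; exists a, b; split=> //.
exact: subseq_trans abs (subseq_cons s x).
Qed.

(** Were all intersections smaller than [#|U| / (4 * q ^ 2)], the first [2 * q] sets, of total size
    at least [2 * #|U|], would have a union larger than [U]. *)
Lemma two_large_sets_meet (V : finType) (U : {set V}) (q : nat) (T : eqType)
    (Z : T -> {set V}) (s : seq T) :
  0 < q -> q.*2 <= size s ->
  (forall x, x \in s -> Z x \subset U /\ #|U| <= q * #|Z x|) ->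
  exists x y, subseq [:: x; y] s /\ #|U| <= 4 * q ^ 2 * #|Z x :&: Z y|.
Proof.
move=> q0 szs Zs.
have [|] := boolP (pairwise (fun x y => 4 * q ^ 2 * #|Z x :&: Z y| < #|U|) s); last first.
  by case/not_pairwise=> x [y [xy]]; rewrite -leqNgt => ?; exists x, y.
have [U0|U0 pw] := posnP #|U|.
  by case: s szs {Zs} => [|x [|y s]] /=; rewrite ?U0 //; lia.
exfalso; pose l := [seq Z x | x <- take q.*2 s].
pose c := #|U|.-1 %/ (4 * q ^ 2).
have szl : size l = q.*2 by rewrite size_map size_takel.
have /sum_card_le_bigcup : pairwise (fun X Y : {set V} => #|X :&: Y| <= c) l.
  rewrite pairwise_map; apply: sub_pairwise (subseq_pairwise (take_subseq _ _) pw).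
  by move=> x y /= ltU; rewrite leq_divRL; nia.
have : #|\bigcup_(X <- l) X| <= #|U|.
  apply: subset_leq_card; rewrite big_map big_seq.
  apply: (big_ind (fun X : {set V} => X \subset U)) => [|X Y XU YU|x /mem_take xs].
  - exact: sub0set.
  - by rewrite subUset XU.
  by case: (Zs x xs).
have : q.*2 * #|U| <= q * \sum_(X <- l) #|X|.
  rewrite -[q.*2](size_takel szs) mulnC -iter_addn_0 -count_predT -big_const_seq.
  rewrite big_map big_distrr /= big_seq [leqRHS]big_seq.
  by apply: leq_sum => x /mem_take xs; case: (Zs x xs).
have : c * (4 * q ^ 2) <= #|U|.-1 by rewrite leq_trunc_div.
rewrite szl; nia.
Qed.

(** The pairs are disjoint, so two of them taken in order form a subsequence of length four; an odd
    last element is dropped. *)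
Fixpoint consecutive_pairs (T : Type) (t : seq T) : seq (T * T) :=
  if t is x :: y :: t' then (x, y) :: consecutive_pairs t' else [::].

Lemma seq_pair_ind (T : Type) (P : seq T -> Prop) :
  P [::] -> (forall x, P [:: x]) -> (forall x y t, P t -> P [:: x, y & t]) ->
  forall t, P t.
Proof.
move=> P0 P1 P2 t; suff: P t /\ forall x, P (x :: t) by case.
by elim: t => [|y t [Pt Pxt]]; split=> // x; apply: P2.
Qed.

Lemma size_consecutive_pairs (T : Type) (t : seq T) :
  size (consecutive_pairs t) = (size t)./2.
Proof. by elim/seq_pair_ind: t => //= x y t ->. Qed.

Lemma subseq_consecutive_pairs (T : eqType) (t : seq T) ps :
  subseq ps (consecutive_pairs t) ->
  subseq (flatten [seq [:: p.1; p.2] | p <- ps]) t.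
Proof.
move: ps; elim/seq_pair_ind: t => [|x|x y t IH] [|p ps] //=; rewrite ?sub0seq //.
case: eqP => [-> /IH|_ /IH]; first by rewrite !eqxx.
by move=> h; apply: (subseq_trans h (subseq_trans (subseq_cons t y) (subseq_cons _ x))).
Qed.

(* The systems [(D i, C i)] record the partial choices: [D i] collects the conditions on
   [b] that no longer mention future vertices, and [C i y] those to be met when [y] is put
   outside [S].  The new vertex [v] is put inside [S] in the first conclusion and outside
   [S] in the second.  In a Ramsey-homogeneous sequence the required intersections are all
   large, because [2 * q] sets of density [1 / q] cannot be almost disjoint. *)
Lemma extend_systems (r q m : nat) : 0 < q ->
  exists M, forall (V : finType) (U : {set V}) (I : finType) (T : eqType)
    (E : T -> T -> {set V}) (D : I -> {set V}) (C : I -> T -> {set V}) (s : seq T),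
  #|I| <= r -> (forall i, D i \subset U) ->
  (forall i x y, subseq [:: x; y] s ->
     #|U| <= q * #|D i :&: E x y :&: C i y|) ->
  M <= size s ->
  exists v s', [/\ subseq (v :: s') s, size s' = m &
    forall i x y, subseq [:: x; y] s' ->
      #|U| <= 4 * q ^ 2 * #|D i :&: E x y :&: (C i y :&: E v y)| /\
      #|U| <= 4 * q ^ 2 * #|D i :&: C i v :&: E x y :&: C i y|].
Proof.
move=> q0.
have [M4 HM4] := ramsey_unavoidable r 4 (4 * q) m.+2.
have [M3 HM3] := ramsey_unavoidable r 3 q.*2.+1 M4.
exists M3 => V U I T E D C s Ir DU heavy Ms.
pose Z i x y := D i :&: E x y :&: C i y.
have ZU i x y : subseq [:: x; y] s -> Z i x y \subset U /\ #|U| <= q * #|Z i x y|.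
  move=> xy; split; last exact: heavy.
  by apply: subset_trans (DU i); rewrite /Z -setIA subsetIl.
pose triple i u := if u is [:: x; y; z]
  then #|U| <= 4 * q ^ 2 * #|Z i x z :&: Z i y z| else false.
pose quad i u := if u is [:: x; y; x'; y']
  then #|U| <= 4 * q ^ 2 * #|Z i x y :&: Z i x' y'| else false.
have [|t3 [ts3 szt3 Ht3]] := HM3 I T triple s Ir _ Ms.
  (* With the last element [z] fixed, the other [2 * q] elements [x] give as many sets [Z i x z]. *)
  move=> i; case/lastP=> // t z ts; rewrite size_rcons ltnS => szt.
  have [x xt|x [y [xyt meet]]] := two_large_sets_meet (U := U) (Z := fun x => Z i x z) q0 szt.
    apply: ZU; apply: subseq_trans ts.
    by rewrite -cats1; apply: (@cat_subseq _ [:: x] [:: z] t [:: z]); rewrite sub1seq ?inE.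
  exists [:: x; y; z]; split=> //.
  by rewrite -cats1; apply: (@cat_subseq _ [:: x; y] [:: z] t [:: z]).
have [||t [ts szt Ht]] := HM4 I T quad t3 Ir; last 2 first.
- by rewrite szt3.
(* The spare element [a] in front of [v] provides the set [Z i a v], which lies in [C i v]. *)
- case: t szt ts Ht => [//|a [//|v s']] /= [szs'] ts Ht.
  have vs't3 : subseq (v :: s') t3 by apply: subseq_trans (subseq_cons _ a) ts.
  exists v, s'; split=> //; first exact: subseq_trans ts3.
  move=> i x y xy; split.
    have := Ht3 i [:: v; x; y] _ erefl; rewrite /= => /(_ _)/leq_trans; apply.
      by apply: subseq_trans vs't3; rewrite /= eqxx.
    rewrite leq_mul2l; apply/orP; right; apply: subset_leq_card.
    apply/subsetP=> b; rewrite !inE.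
    by case/andP=> /andP[/andP[_ ->] _] /andP[/andP[-> ->] ->].
  have := Ht i [:: a; v; x; y] _ erefl; rewrite /= => /(_ _)/leq_trans; apply.
    by rewrite /= !eqxx.
  rewrite leq_mul2l; apply/orP; right; apply: subset_leq_card.
  apply/subsetP=> b; rewrite !inE.
  by case/andP=> /andP[/andP[_ _] ->] /andP[/andP[-> ->] ->].
move=> i t tt3 szt.
have sz2 : q.*2 <= size (consecutive_pairs t) by rewrite size_consecutive_pairs; lia.
have [[x y] xt|[x y] [[x' y'] [xyt meet]]] :=
    two_large_sets_meet (U := U) (Z := fun p => Z i p.1 p.2) q0 sz2.
  apply: ZU; apply: subseq_trans ts3; apply: subseq_trans tt3.
  by apply: (@subseq_consecutive_pairs _ t [:: (x, y)]); rewrite sub1seq.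
exists [:: x; y; x'; y']; split=> //.
exact: (@subseq_consecutive_pairs _ t [:: (x, y); (x', y')]).
Qed.

Section Core.
Variables (V : finType) (T : eqType) (E : T -> T -> {set V}) (S : pred T).

(** The points of [D] that lie in [C y] for each [y] of [vs] outside [S], and in [E x y] whenever
    [x] in [S] precedes such a [y]. Each recursive call performs one of the two updates of
    [extend_systems]. *)
Fixpoint core (D : {set V}) (C : T -> {set V}) (vs : seq T) : {set V} :=
  if vs is v :: vs' then
    if S v then core D (fun y => C y :&: E v y) vs' else core (D :&: C v) C vs'
  else D.

Lemma core_sub D C vs : core D C vs \subset D.
Proof.
elim: vs D C => //= v vs IH D C; case: ifP => _; first exact: IH.
exact: subset_trans (IH _ _) (subsetIl _ _).
Qed.

Lemma core_filter D C vs b y : b \in core D C vs -> y \in vs -> ~~ S y -> b \in C y.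
Proof.
elim: vs D C => //= v vs IH D C; rewrite inE.
case: ifPn => [Sv bc /orP[/eqP->|yvs] Sy|Sv bc /orP[/eqP->|yvs] Sy].
- by rewrite Sv in Sy.
- by have := IH _ _ bc yvs Sy; rewrite inE => /andP[].
- by have := subsetP (core_sub _ _ _) _ bc; rewrite inE => /andP[].
exact: IH bc yvs Sy.
Qed.

Lemma core_edge D C vs b x y : b \in core D C vs ->
  subseq [:: x; y] vs -> S x -> ~~ S y -> b \in E x y.
Proof.
elim: vs D C => //= v vs IH D C; case: eqP => [<-|_]; last first.
  by case: ifP => _; apply: IH.
rewrite sub1seq => bc yvs Sx Sy; rewrite Sx in bc.
by have := core_filter bc yvs Sy; rewrite inE => /andP[].
Qed.

End Core.

(** One sequence has to serve all [S], so every system branches at each new vertex according to its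
    membership in [S]. Hence [r] becomes [2 * r], and the density [1 / q] becomes
    [1 / (4 * q ^ 2)]. *)
Lemma large_cores (k r q : nat) : 0 < q ->
  exists M Q, 0 < Q /\ forall (V : finType) (U : {set V}) (I : finType) (T : eqType)
    (E : T -> T -> {set V}) (D : I -> {set V}) (C : I -> T -> {set V}) (s : seq T),
  #|I| <= r -> (forall i, D i \subset U) ->
  (forall i x y, subseq [:: x; y] s ->
     #|U| <= q * #|D i :&: E x y :&: C i y|) ->
  M <= size s ->
  exists vs, [/\ subseq vs s, size vs = k &
    forall i S, #|U| <= Q * #|core E S (D i) (C i) vs|].
Proof.
elim: k r q => [|k IH] r q q0.
  (* Two elements of [s] are needed for the hypothesis on pairs to bound [D i] from below. *)
  exists 2, q; split=> // V U I T E D C [|x [|y s]] // Ir DU heavy _.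
  exists [::]; split; rewrite ?sub0seq // => i S /=.
  have := heavy i x y; rewrite /= !eqxx sub0seq => /(_ isT)/leq_trans; apply.
  rewrite leq_mul2l; apply/orP; right; apply: subset_leq_card.
  by rewrite -setIA subsetIl.
have q'0 : 0 < 4 * q ^ 2 by nia.
have [M' [Q [Q0 HQ]]] := IH (2 * r) _ q'0.
have [M HM] := extend_systems r M' q0.
exists M, Q; split=> // V U I T E D C s Ir DU heavy Ms.
have [v [s' [vs's szs' Hs']]] := HM _ U I _ E D C s Ir DU heavy Ms.
pose D' (p : I * bool) := if p.2 then D p.1 else D p.1 :&: C p.1 v.
pose C' (p : I * bool) := if p.2 then (fun y => C p.1 y :&: E v y) else C p.1.
have [||||vs [vss' szvs Hvs]] := HQ _ U _ _ E D' C' s'.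
- by rewrite card_prod card_bool mulnC leq_mul2l.
- by case=> i [] /=; rewrite /D' //=; apply: subset_trans (DU i); rewrite subsetIl.
- by case=> i [] x y /(Hs' i)[]; rewrite /D' /C' /=.
- by rewrite szs'.
exists (v :: vs); rewrite /= szvs; split=> //.
  by apply: subseq_trans vs's; rewrite /= eqxx.
by move=> i S; have := Hvs (i, S v) S; rewrite /D' /C' /=; case: (S v).
Qed.

Theorem shattered_subsequence (k q : nat) : 0 < q ->
  exists M Q, 0 < Q /\ forall (V : finType) (U : {set V}) (T : eqType)
    (E : T -> T -> {set V}) (s : seq T),
  (forall x y, subseq [:: x; y] s -> #|U| <= q * #|U :&: E x y|) ->
  M <= size s ->
  exists vs, [/\ subseq vs s, size vs = k &
    forall S : pred T, exists2 X : {set V}, #|U| <= Q * #|X| &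
      forall b x y, b \in X -> subseq [:: x; y] vs -> S x -> ~~ S y -> b \in E x y].
Proof.
move=> q0; have [M [Q [Q0 HQ]]] := large_cores k 1 q0.
exists M, Q; split=> // V U T E s heavy Ms.
have [||||vs [vss szvs Hvs]] := HQ V U unit T E (fun=> U) (fun _ _ => setT) s.
- by rewrite card_unit.
- by [].
- by move=> _ x y /heavy; rewrite setIT.
- by [].
exists vs; split=> // S; exists (core E S U (fun=> setT) vs); first exact: (Hvs tt).
by move=> b x y; apply: core_edge.
Qed.

(** * Copies of oriented patterns *)

(** Greedy choice: at most [#|Z| + #|W| - 1] points are forbidden at each step. *)
Lemma distinct_representatives (W V : finType) (Y : W -> {set V}) (Z : {set V}) :
  (forall w, #|Z| + #|W| <= #|Y w|) ->
  exists f : W -> V, injective f /\ forall w, f w \in Y w :\: Z.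
Proof.
(* An empty [W] is treated apart, as [V] may then be empty and offer no default value. *)
move=> YZ; have [w0 _|W0] := pickP (fun _ : W => true); last first.
  by exists (fun w => False_rect V (Bool.diff_true_false (W0 w))); split=> w; have := W0 w.
have pick_new (X : {set V}) w : #|X| < #|Y w| -> exists v, v \in Y w :\: X.
  move=> ltX; apply/set0Pn; apply: contraTneq ltX => /eqP.
  by rewrite setD_eq0 -leqNgt => /subset_leq_card.
suff [f [finj fY]] : exists f : W -> V,
    {in enum W &, injective f} /\ {in enum W, forall w, f w \in Y w :\: Z}.
  by exists f; split=> [x y|w]; [apply: finj|apply: fY]; rewrite mem_enum.
elim: (enum W) (enum_uniq W) => [_|w l IH /=/andP[wl /[dup] ul /IH[f [finj fY]]]].
  have [|v _] := pick_new Z w0.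
    by apply: leq_trans (YZ w0); rewrite -addn1 leq_add2l; apply/card_gt0P; exists w0.
  by exists (fun=> v).
have [|v] := pick_new (Z :|: [set f x | x in l]) w.
  apply: leq_trans (YZ w); apply: leq_ltn_trans (leq_card_setU _ _) _.
  rewrite ltn_add2l; apply: leq_ltn_trans (leq_imset_card _ _) _.
  have /card_uniqP card_wl : uniq (w :: l) by rewrite /= wl.
  by rewrite (card_uniqP ul) -[X in X <= _]/(size (w :: l)) -card_wl max_card.
rewrite !inE negb_or => /andP[/andP[vZ vf] vY].
exists (fun x => if x == w then v else f x); split=> [x y|x]; rewrite !inE.
  have fresh z : z \in l -> v != f z.
    by apply: contraTneq => vfz; apply: contra vf => zl; rewrite vfz imset_f.
  case: eqP => [->|_] /= xl; case: eqP => [->|_] //= yl.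
  - by move=> vfy; have := fresh y yl; rewrite vfy eqxx.
  - by move=> vfx; have := fresh x xl; rewrite -vfx eqxx.
  exact: finj.
case: eqP => [-> _|_ /= /fY]; first by rewrite vZ.
by rewrite inE.
Qed.

Lemma subseq_nth2 (T : eqType) (x0 y0 : T) (s : seq T) (i j : nat) :
  i < j -> j < size s -> subseq [:: nth x0 s i; nth y0 s j] s.
Proof.
elim: s i j => [|z s IH] [|i] [|j] //= ij js; first by rewrite eqxx sub1seq mem_nth.
exact: subseq_trans (IH i j ij js) (subseq_cons s z).
Qed.

(* Here [r] orders the vertices satisfying [P], and the link graph of each remaining
   vertex [b] is directed from [S b] to its complement. *)
Definition oriented_links (W : finType) (EF : {set {set W}}) (P : pred W)
    (r : W -> nat) (S : W -> pred W) : Prop :=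
  {in P &, injective r} /\
  forall e, e \in EF -> exists a1 a2 b,
    [/\ e = [set a1; a2; b], [&& P a1, P a2 & ~~ P b], r a1 < r a2, S b a1
      & ~~ S b a2].

(** The vertices satisfying [P] go, in the order [r], to the first terms of a shattered sequence;
    every other [b] goes to a point of the large set that shattering provides for the image of
    [S b]. *)
Lemma oriented_links_copy (k q : nat) : 0 < q ->
  exists M N, forall (W : finType) (EF : {set {set W}}) P r S,
    #|W| <= k -> oriented_links EF P r S ->
  forall (V : finType) (E : {set {set V}}) (U : {set V}) (s : seq V),
    uniq s ->
    (forall x y, subseq [:: x; y] s ->
       #|U| <= q * #|[set z in U | [set x; y; z] \in E]|) ->
    M <= size s -> N <= #|U| -> has_copy EF E.
Proof.
move=> q0; have [M [Q [Q0 HQ]]] := shattered_subsequence k q0.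
exists M, (Q * (k + k)) => W EF P r S Wk [rinj EFP] V E U s us heavy Ms NU.
pose Exy x y := [set z | [set x; y; z] \in E].
have [|vs [vss szvs Hvs]] := HQ V U V Exy s _ Ms.
  by move=> x y /heavy; rewrite /Exy setIdE.
have uvs : uniq vs := subseq_uniq vss us.
(* The values of [r] may have gaps; [rank] turns them into indices in [vs]. *)
pose rank a := #|[set j | P j & r j < r a]|.
have rank_lt a : P a -> rank a < size vs.
  move=> Pa; rewrite szvs; apply: leq_trans Wk; rewrite -cardsT.
  by apply: proper_card; apply/properP; split=> //; exists a; rewrite !inE ?ltnn ?andbF.
have rank_mono a a' : P a -> P a' -> r a < r a' -> rank a < rank a'.
  move=> Pa Pa' raa'; apply: proper_card; apply/properP; split.
    apply/subsetP=> j; rewrite !inE => /andP[-> /=] rj; exact: ltn_trans raa'.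
  by exists a; rewrite !inE ?ltnn ?andbF // Pa.
have rank_inj a a' : P a -> P a' -> rank a = rank a' -> a = a'.
  move=> Pa Pa' raa'; apply: rinj => //.
  have [lt|lt|//] := ltngtP (r a) (r a').
    by have := rank_mono _ _ Pa Pa' lt; rewrite raa' ltnn.
  by have := rank_mono _ _ Pa' Pa lt; rewrite raa' ltnn.
pose S' b v := [exists a, [&& P a, S b a & rank a == index v vs]].
(* One [k] pays for avoiding [vs], the other for keeping the images distinct. *)
have large b : exists X : {set V}, (k + k <= #|X|) /\ forall v x y, v \in X ->
    subseq [:: x; y] vs -> S' b x -> ~~ S' b y -> v \in Exy x y.
  have [X UX HX] := Hvs (S' b); exists X; split=> //.
  by rewrite -(leq_pmul2l Q0); apply: leq_trans UX.
have [Y HY] := fin_all_exists large.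
have [w|f [finj fY]] := @distinct_representatives W V Y [set x in vs].
  case: (HY w) => kY _; apply: leq_trans kY; apply: leq_add Wk.
  by rewrite cardsE (card_uniqP uvs) szvs.
pose g w := if P w then nth (f w) vs (rank w) else f w.
have fvs w : f w \notin vs by have := fY w; rewrite !inE => /andP[].
exists g; split=> [w1 w2|e /EFP[a1 [a2 [b [-> /and3P[P1 P2 nPb] r12 S1 S2]]]]].
  rewrite /g; case: ifPn => P1; case: ifPn => P2.
  - rewrite (set_nth_default (f w1)) ?rank_lt // => /eqP.
    by rewrite nth_uniq ?rank_lt // => /eqP; apply: rank_inj.
  - by move=> E12; case/negP: (fvs w2); rewrite -E12 mem_nth ?rank_lt //.
  - by move=> E12; case/negP: (fvs w1); rewrite E12 mem_nth ?rank_lt //.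
  exact: finj.
rewrite !imsetU !imset_set1 /g P1 P2 (negbTE nPb).
case: (HY b) => _ /(_ (f b) (nth (f a1) vs (rank a1)) (nth (f a2) vs (rank a2))).
rewrite inE; apply.
- by have := fY b; rewrite inE => /andP[].
- by apply: subseq_nth2; rewrite ?rank_lt ?rank_mono //.
- by apply/existsP; exists a1; rewrite P1 S1 index_uniq ?rank_lt ?eqxx.
apply/existsP=> -[a /and3P[Pa Sa]]; rewrite index_uniq ?rank_lt // => /eqP ra.
suff aa2 : a = a2 by rewrite aa2 (negbTE S2) in Sa.
exact: rank_inj.
Qed.

(** Each choice shrinks the set of candidates by a factor of at most [p], so [step] stays applicable
    for all [M] choices. *)
Lemma greedy_clique (V : finType) (h : rel V) (p M : nat) (U : {set V}) :
  0 < p -> irreflexive h ->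
  (forall A : {set V}, A \subset U -> #|U| <= p ^ M * #|A| ->
     exists2 v, v \in A & #|A| <= p * #|[set y in A | h v y]|) ->
  exists s, [/\ uniq s, size s = M & forall x y, subseq [:: x; y] s -> h x y].
Proof.
move=> p0 hirr step.
(* Here [j] counts the vertices still to be chosen. *)
suff claim j (A : {set V}) : j <= M -> A \subset U -> #|U| <= p ^ (M - j) * #|A| ->
    exists s, [/\ size s = j, {subset s <= A} & pairwise h s].
  have [|s [szs sU hs]] := claim M U (leqnn M) (subxx U); first by rewrite subnn mul1n.
  exists s; split=> //; first exact: pairwise_uniq hs.
  by move=> x y /subseq_pairwise/(_ hs); rewrite /= !andbT.
elim: j A => [|j IH] A jM AU UA; first by exists [::].
have [|v vA Av] := step A AU.
  by apply: leq_trans UA _; rewrite leq_mul2r leq_pexp2l ?orbT // leq_subr.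
have [|||s [szs sA hs]] := IH [set y in A | h v y]; first exact: ltnW.
- by apply: subset_trans AU; apply/subsetP=> y; rewrite inE => /andP[].
- apply: leq_trans UA _; rewrite -(subnSK jM) expnSr -mulnA leq_mul2l.
  by apply/orP; right.
exists (v :: s); split=> /=; first by rewrite szs.
- by move=> y; rewrite inE => /orP[/eqP->//|/sA]; rewrite inE => /andP[].
by rewrite hs andbT; apply/allP=> y /sA; rewrite inE => /andP[].
Qed.

(** * Counting degrees and codegrees *)

Section CountingInThreeGraphs.
Variables (V : finType) (E : {set {set V}}) (U : {set V}).
Definition edges_in (W : {set V}) := [set e in E | e \subset W].
Definition degree_in (x : V) := #|[set e in edges_in U | x \in e]|.
Definition codegree_in (x y : V) := #|[set e in edges_in U | (x \in e) && (y \in e)]|.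

Lemma card_setI_sum (e A : {set V}) : #|e :&: A| = \sum_(x in A) (x \in e).
Proof.
rewrite -sum1_card big_mkcond [RHS]big_mkcond; apply: eq_bigr => x _.
by rewrite inE; case: (x \in e); case: (x \in A).
Qed.

Lemma sum_degree_in (A : {set V}) :
  \sum_(e in edges_in U) #|e :&: A| = \sum_(x in A) degree_in x.
Proof.
under eq_bigr do rewrite card_setI_sum.
rewrite exchange_big; apply: eq_bigr => x _.
by rewrite /degree_in -sum1dep_card big_mkcondr /=; apply: eq_bigr => e _; case: ifP.
Qed.

Lemma sum_codegree_in (A : {set V}) :
  \sum_(e in edges_in U) #|e :&: A| ^ 2 = \sum_(x in A) \sum_(y in A) codegree_in x y.
Proof.
transitivity (\sum_(e in edges_in U) \sum_(x in A) \sum_(y in A) (x \in e) * (y \in e)).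
  apply: eq_bigr => e _; rewrite card_setI_sum -mulnn big_distrl /=.
  by apply: eq_bigr => x _; rewrite big_distrr.
rewrite exchange_big; apply: eq_bigr => x _.
rewrite exchange_big; apply: eq_bigr => y _.
rewrite /codegree_in -sum1dep_card big_mkcondr /=; apply: eq_bigr => e _.
by do 2!case: (_ \in e).
Qed.

Lemma codegree_in_diag x : codegree_in x x = degree_in x.
Proof. by apply: eq_card => e; rewrite !inE andbb. Qed.

Definition offdiag_codegree (A : {set V}) :=
  \sum_(x in A) \sum_(y in A | y != x) codegree_in x y.

Lemma sum_codegree_in_offdiag (A : {set V}) :
  \sum_(x in A) \sum_(y in A) codegree_in x y =
  \sum_(x in A) degree_in x + offdiag_codegree A.
Proof.
rewrite -big_split; apply: eq_bigr => x xA /=.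
by rewrite (bigD1 x) //= codegree_in_diag.
Qed.

(* Summing [2 * (a == 0) + 3 * a <= 2 + a ^ 2], i.e. [(a - 1) * (a - 2) >= 0], over
   the edges, with [a] the size of the intersection with [A]. *)
Lemma edges_in_setD (A : {set V}) :
  2 * #|edges_in (U :\: A)| + 2 * \sum_(x in A) degree_in x <=
  2 * #|edges_in U| + offdiag_codegree A.
Proof.
have : 2 * #|edges_in (U :\: A)| + 3 * \sum_(e in edges_in U) #|e :&: A| <=
       2 * #|edges_in U| + \sum_(e in edges_in U) #|e :&: A| ^ 2.
  have -> : #|edges_in (U :\: A)| = \sum_(e in edges_in U) (e :&: A == set0).
    rewrite -sum1_card [RHS]big_mkcond [LHS]big_mkcond; apply: eq_bigr => e _.
    by rewrite !inE subsetD -setI_eq0; case: (e \in E); case: (e \subset U) => //=; case: (_ == _).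
  rewrite -sum1_card !big_distrr /= -!big_split /=; apply: leq_sum => e _.
  rewrite -cards_eq0; case: #|e :&: A| => [|[|a]] //=; nia.
rewrite sum_codegree_in sum_codegree_in_offdiag sum_degree_in; lia.
Qed.

Hypothesis E3 : is3graph E.

Lemma edge_through2 e x y : e \in E -> x \in e -> y \in e -> x != y ->
  exists2 z, z \in e & e = [set x; y; z].
Proof.
move=> eE xe ye xy; have /eqP e3 : #|e| == 3 by have /forall_inP := E3; apply.
have ye' : y \in e :\ x by rewrite !inE eq_sym xy.
have /cards1P[z ez] : #|(e :\ x) :\ y| == 1.
  by move: (cardsD1 x e) (cardsD1 y (e :\ x)); rewrite xe ye' e3; lia.
have : z \in e :\ x :\ y by rewrite ez set11.
rewrite !inE => /and3P[_ _ ze].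
by exists z; rewrite // -setUA -[[set y; z]]/(y |: [set z]) -ez !setD1K.
Qed.

Lemma edge_through1 e x : e \in E -> x \in e ->
  exists y z, [/\ y \in e, z \in e & e = [set x; y; z]].
Proof.
move=> eE xe; have /eqP e3 : #|e| == 3 by have /forall_inP := E3; apply.
have /card_gt0P[y] : 0 < #|e :\ x| by have := cardsD1 x e; rewrite xe e3; lia.
rewrite !inE eq_sym => /andP[xy ye].
by have [z ze exyz] := edge_through2 eE xe ye xy; exists y, z.
Qed.

Lemma degree_in_le x : degree_in x <= #|U| ^ 2.
Proof.
apply: (@leq_trans #|[set [set x; p.1; p.2] | p in setX U U]|).
  apply: subset_leq_card; apply/subsetP=> e; rewrite !inE -andbA => /and3P[eE eU xe].
  have [y [z [ye ze ->]]] := edge_through1 eE xe.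
  by apply/imsetP; exists (y, z) => //; rewrite inE !(subsetP eU).
by apply: leq_trans (leq_imset_card _ _) _; rewrite cardsX.
Qed.

Lemma codegree_in_le x y : x != y ->
  codegree_in x y <= #|[set z in U | [set x; y; z] \in E]|.
Proof.
move=> xy; apply: (@leq_trans
    #|[set [set x; y; z] | z in [set z in U | [set x; y; z] \in E]]|).
  apply: subset_leq_card; apply/subsetP=> e.
  rewrite !inE -andbA => /and4P[eE eU xe ye].
  have [z ze exyz] := edge_through2 eE xe ye xy.
  by apply/imsetP; exists z; rewrite // !inE (subsetP eU) //= -exyz.
exact: leq_imset_card.
Qed.

Lemma offdiag_codegree_le (A : {set V}) : offdiag_codegree A <= #|A| ^ 2 * #|U|.
Proof.
rewrite -mulnn -mulnA -sum_nat_const; apply: leq_sum => x _.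
rewrite -sum_nat_const [leqRHS](bigID (fun y => y != x)) /=.
apply: leq_trans (leq_addr _ _); apply: leq_sum => y /andP[_ yx].
apply: leq_trans (codegree_in_le _) _; first by rewrite eq_sym.
by apply: subset_leq_card; apply/subsetP=> z; rewrite inE => /andP[].
Qed.

(** Averaging: if each [x] had fewer than [#|A| / q] heavy partners, then in [q] times its codegree
    sum these would contribute less than [#|A| * #|U|], and the light ones at most as much. *)
Lemma many_heavy_codegrees (q : nat) (A : {set V}) : 0 < #|U| -> 0 < #|A| ->
  2 * #|U| * #|A| ^ 2 <= q * offdiag_codegree A ->
  exists2 x, x \in A &
    #|A| <= q * #|[set y in A | (x != y) && (#|U| <= q * codegree_in x y)]|.
Proof.
move=> U0 A0 dense; apply/exists_inP; apply: contraLR dense => /exists_inPn few.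
rewrite -ltnNge big_distrr /=.
(* The predecessor records the strictness for each [x]; as [A] is nonempty, it survives
   summation. *)
apply: (@leq_trans (\sum_(x in A) (2 * #|U| * #|A|).-1).+1); last first.
  by rewrite sum_nat_const; nia.
rewrite ltnS; apply: leq_sum => x xA.
pose heavy y := #|U| <= q * codegree_in x y.
have := few x xA; rewrite -ltnNge => hA.
rewrite big_distrr /= (bigID heavy) /=.
have : \sum_(y in A | (y != x) && ~~ heavy y) q * codegree_in x y <= #|A| * #|U|.
  rewrite -sum_nat_const [leqRHS](bigID (fun y => (y != x) && ~~ heavy y)) /=.
  apply: leq_trans (leq_addr _ _); apply: leq_sum => y /and3P[_ _].
  by rewrite -ltnNge => /ltnW.
have : \sum_(y in A | (y != x) && heavy y) q * codegree_in x y <=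
    q * #|[set y in A | (x != y) && heavy y]| * #|U|.
  rewrite -mulnA -sum_nat_const big_distrr /=.
  rewrite [leqRHS]big_mkcond [leqLHS]big_mkcond /=; apply: leq_sum => y _.
  rewrite inE [x == y]eq_sym; case: ifP => // /and3P[yA yx hy].
  rewrite leq_mul2l; apply/orP; right; apply: leq_trans (codegree_in_le _) _.
    by rewrite eq_sym.
  by apply: subset_leq_card; apply/subsetP=> z; rewrite inE => /andP[].
under eq_bigl do rewrite andbA; under [X in _ -> X <= _ -> _]eq_bigl do rewrite andbA.
have : (q * #|[set y in A | (x != y) && heavy y]|).+1 * #|U| <= #|A| * #|U|.
  by rewrite leq_mul2r hA orbT.
lia.
Qed.

End CountingInThreeGraphs.

(** * Uniformly dense 3-graphs *)

Local Open Scope ring_scope.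

Lemma exists_subset_card (V : finType) (A : {set V}) (c : nat) : (c <= #|A|)%N ->
  exists2 C : {set V}, C \subset A & #|C| = c.
Proof.
case/card_geqP=> s [us <- sA]; exists [set x in s].
  by apply/subsetP=> x; rewrite inE => /sA.
by rewrite cardsE (card_uniqP us).
Qed.

(** Expanding the cube and dropping a nonnegative multiple of [d] leaves [8 * g * x * u ^ 2 <= 4 * g
    ^ 2 * u ^ 3 + x ^ 2 * u]. As [x] lies between [g * u] and [2 * g * u], the right side is at most
    [6 * g * x * u ^ 2]. *)
Lemma removal_contradiction (R : realFieldType) (d g u x s p e e' : R) :
  0 <= d -> 0 < g -> 1 <= g * u -> x <= 2 * g * u -> 2 * g * u < x + 1 -> x <= u ->
  e <= d / 6 * u ^+ 3 + g ^+ 2 * u ^+ 3 ->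
  x * ((d / 2 + 4 * g) * u ^+ 2) <= s -> p <= x ^+ 2 * u ->
  d / 6 * (u - x) ^+ 3 - g ^+ 2 * u ^+ 3 <= e' -> 2 * e' + 2 * s <= 2 * e + p -> False.
Proof.
move=> d0 g0 gu c_le c_gt xu h1 h2 h3 h4 h5.
have gux : g * u <= x by lra.
have x0 : 0 < x by lra.
have u0 : 0 < u by lra.
have k1 : 0 <= d * (x ^+ 2 * (u - x / 3)).
  by apply: mulr_ge0 => //; apply: mulr_ge0; [apply: sqr_ge0|lra].
have k2 : 8 * (g * x * u ^+ 2) <= 4 * (g ^+ 2 * u ^+ 3) + x ^+ 2 * u by lra.
have k3 : g ^+ 2 * u ^+ 3 <= g * x * u ^+ 2.
  have -> : g ^+ 2 * u ^+ 3 = g * u ^+ 2 * (g * u) by ring.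
  have -> : g * x * u ^+ 2 = g * u ^+ 2 * x by ring.
  by apply: ler_wpM2l => //; apply: mulr_ge0; [apply: ltW|apply: sqr_ge0].
have k4 : x ^+ 2 * u <= 2 * (g * x * u ^+ 2).
  have -> : x ^+ 2 * u = x * u * x by ring.
  have -> : 2 * (g * x * u ^+ 2) = x * u * (2 * g * u) by ring.
  by apply: ler_wpM2l => //; apply: mulr_ge0; apply: ltW.
have k5 : 0 < g * x * u ^+ 2 by rewrite !mulr_gt0 // exprn_gt0.
lra.
Qed.

(** * Degrees and codegrees in a set of nearly minimal density *)

Section LocallyDense.
Variables (R : realType) (V : finType) (E : {set {set V}}) (U : {set V}) (d g : R).
Hypotheses (E3 : is3graph E) (d0 : 0 <= d) (g0 : 0 < g) (g1 : g <= 1).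
Let u : R := #|U|%:R.
Hypothesis gu : 1 <= g * u.
Hypothesis dense : forall W : {set V}, W \subset U ->
  d / 6 * #|W|%:R ^+ 3 - g ^+ 2 * u ^+ 3 <= #|edges_in E W|%:R.
Hypothesis tight : #|edges_in E U|%:R <= d / 6 * u ^+ 3 + g ^+ 2 * u ^+ 3.

Let u0 : 0 < u.
Proof. by rewrite ltNge; apply/negP => u0; move: gu g0; nra. Qed.

Lemma dense_setD (A : {set V}) : A \subset U ->
  d / 6 * (u - #|A|%:R) ^+ 3 - g ^+ 2 * u ^+ 3 <= #|edges_in E (U :\: A)|%:R.
Proof.
move=> AU; have := dense (subsetDl U A).
by rewrite cardsDS // natrB // subset_leq_card.
Qed.

Lemma edges_in_setD_real (A : {set V}) :
  2 * #|edges_in E (U :\: A)|%:R + 2 * (\sum_(x in A) degree_in E U x)%:R <=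
  2 * #|edges_in E U|%:R + (offdiag_codegree E U A)%:R :> R.
Proof. by have := edges_in_setD E U A; rewrite -(ler_nat R) 2!natrD 3!natrM. Qed.

(* A large set of vertices of degree above average could be removed to push the density of
   [U] below [d]. *)
Lemma few_large_degrees (L : {set V}) : L \subset U ->
  (forall x, x \in L -> (d / 2 + 4 * g) * u ^+ 2 <= (degree_in E U x)%:R) ->
  #|L|%:R <= 2 * g * u.
Proof.
move=> LU Ldeg; rewrite leNgt; apply/negP => gL.
have gu0 : 0 <= 2 * g * u by rewrite !mulr_ge0 ?ltW.
(* Removing about [2 * g * u] vertices balances the two losses: the density error of order
   [g ^ 2 * u ^ 3] and the pair term [c ^ 2 * u]. *)
pose c := Num.truncn (2 * g * u).
have /andP[c_le c_gt] := truncn_itv gu0; 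
have cL : (c <= #|L|)%N by rewrite -(ler_nat R) (le_trans c_le) // ltW.
have [C CL cardC] := exists_subset_card cL.
have CU : C \subset U by apply: subset_trans LU.
have := edges_in_setD_real C; have := dense_setD CU.
have : (offdiag_codegree E U C)%:R <= c%:R ^+ 2 * u :> R.
  by rewrite -cardC -natrX -natrM ler_nat offdiag_codegree_le.
have : c%:R * ((d / 2 + 4 * g) * u ^+ 2) <= (\sum_(x in C) degree_in E U x)%:R.
  rewrite natr_sum -cardC mulr_natl -sumr_const; apply: ler_sum => x xC.
  by apply: Ldeg; apply: subsetP CL _ xC.
have cu : c%:R <= u by rewrite -cardC ler_nat subset_leq_card.
rewrite cardC => h2 h3 h4 h5.
have c_gt' : 2 * g * u < c%:R + 1 by rewrite natr1.
exact: (removal_contradiction d0 g0 gu c_le c_gt' cu tight h2 h3 h4 h5).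
Qed.

(** The total degree is three times the number of edges. Outside [A], all but [2 * g * u] vertices
    have degree below [(d / 2 + 4 * g) * u ^ 2], and those few have degree at most [u ^ 2]; the
    errors add up to [3 + 4 + 2 = 9]. *)
Lemma sum_degree_ge (A : {set V}) : A \subset U ->
  d / 2 * #|A|%:R * u ^+ 2 - 9 * g * u ^+ 3 <= (\sum_(x in A) degree_in E U x)%:R.
Proof.
move=> AU.
have total : 3 * #|edges_in E U|%:R = (\sum_(x in U) degree_in E U x)%:R :> R.
  rewrite -sum_degree_in -natrM mulnC -sum_nat_const; congr _%:R.
  apply: eq_bigr => e; rewrite !inE => /andP[eE /setIidPl->].
  by have /forall_inP/(_ e eE)/eqP := E3.
pose L := [set x in U | (d / 2 + 4 * g) * u ^+ 2 <= (degree_in E U x)%:R].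
have LU : L \subset U by apply/subsetP=> x; rewrite inE => /andP[].
have few : #|L|%:R <= 2 * g * u.
  by apply: few_large_degrees => // x; rewrite inE => /andP[].
have split_sum : (\sum_(x in U) degree_in E U x)%:R =
    (\sum_(x in A) degree_in E U x)%:R + (\sum_(x in U :\: A) degree_in E U x)%:R :> R.
  by rewrite -natrD (big_setID A) /= (setIidPr AU).
have rest : (\sum_(x in U :\: A) degree_in E U x)%:R <=
    (u - #|A|%:R) * ((d / 2 + 4 * g) * u ^+ 2) + #|L|%:R * u ^+ 2.
  set K := (d / 2 + 4 * g) * u ^+ 2.
  have -> : (u - #|A|%:R) * K = \sum_(x in U :\: A) K.
    by rewrite sumr_const cardsDS // -[RHS]mulr_natl natrB // subset_leq_card.
  have -> : #|L|%:R * u ^+ 2 = \sum_(x in L) u ^+ 2 by rewrite sumr_const mulr_natl.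
  rewrite natr_sum big_mkcond [\sum_(x in U :\: A) K]big_mkcond.
  rewrite [\sum_(x in L) _]big_mkcond -big_split /=; apply: ler_sum => x _.
  have deg_le : (degree_in E U x)%:R <= u ^+ 2 by rewrite /u -natrX ler_nat degree_in_le.
  have K0 : 0 <= K by rewrite mulr_ge0 ?sqr_ge0 //; move: d0 g0; lra.
  rewrite !inE; case: (x \in A); case: (x \in U) => //=; rewrite ?addr0 ?add0r //.
    by case: ifP; rewrite ?sqr_ge0.
  case: ifPn => [_|]; first by apply: le_trans deg_le _; rewrite lerDr.
  by rewrite -ltNge addr0 => /ltW.
have lower := dense (subxx U); rewrite -/u in lower.
have k1 : #|L|%:R * u ^+ 2 <= 2 * g * u * u ^+ 2 by rewrite ler_wpM2r // sqr_ge0.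
have k2 : g ^+ 2 * u ^+ 3 <= g * u ^+ 3.
  by rewrite ler_wpM2r ?exprn_ge0 ?(ltW u0) // expr2 ger_pMr.
have k3 : 0 <= g * u ^+ 2 * #|A|%:R by rewrite !mulr_ge0 ?sqr_ge0 ?(ltW g0).
move: lower rest k1 k2 k3; rewrite -total in split_sum.
move: split_sum; rewrite !exprS !expr0; nra.
Qed.

(** In [edges_in_setD] the terms of degree at most one in [#|A|] cancel up to the error, leaving
    [d * #|A| ^ 2 * (u - #|A| / 3)], where [#|A| <= u]. The error is [2 * 9 + 4 = 22]. *)
Lemma offdiag_codegree_ge (A : {set V}) : A \subset U ->
  2 / 3 * d * u * #|A|%:R ^+ 2 - 22 * g * u ^+ 3 <= (offdiag_codegree E U A)%:R.
Proof.
move=> AU; have := edges_in_setD_real A; have := dense_setD AU.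
have := sum_degree_ge AU; move: tight.
have au : #|A|%:R <= u by rewrite ler_nat subset_leq_card.
have k2 : g ^+ 2 * u ^+ 3 <= g * u ^+ 3.
  by rewrite ler_wpM2r ?exprn_ge0 ?(ltW u0) // expr2 ger_pMr.
have k1 : 0 <= d * #|A|%:R ^+ 2 * (u - #|A|%:R).
  by rewrite !mulr_ge0 ?sqr_ge0 ?subr_ge0.
move: k1 k2; rewrite !exprS !expr0; nra.
Qed.

End LocallyDense.

(** For [#|A|] at least [#|U| / q ^ M] the error [22 * g * #|U| ^ 3] costs at most [d / 6] of the
    main coefficient [2 / 3 * d], as [132 = 6 * 22]. The remaining [d / 2], times [q], is at least
    [2], as [many_heavy_codegrees] requires. *)
Lemma locally_dense_clique (R : realType) (V : finType) (E : {set {set V}})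
    (U : {set V}) (d g : R) (q M : nat) :
  is3graph E -> 0 <= d -> 0 < g -> g <= 1 -> 1 <= g * #|U|%:R ->
  (forall W : {set V}, W \subset U ->
     d / 6 * #|W|%:R ^+ 3 - g ^+ 2 * #|U|%:R ^+ 3 <= #|edges_in E W|%:R) ->
  #|edges_in E U|%:R <= d / 6 * #|U|%:R ^+ 3 + g ^+ 2 * #|U|%:R ^+ 3 ->
  4 <= q%:R * d -> 132 * g * (q ^ M)%:R ^+ 2 <= d ->
  exists s, [/\ uniq s, size s = M & forall x y, subseq [:: x; y] s ->
    (#|U| <= q * #|[set z in U | [set x; y; z] \in E]|)%N].
Proof.
move=> E3 d0 g0 g1 gu dense tight qd small.
have U0 : (0 < #|U|)%N.
  by rewrite lt0n; apply/negP => /eqP U0; rewrite U0 mulr0 ler10 in gu.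
have q0 : (0 < q)%N.
  by rewrite lt0n; apply/negP => /eqP q0; move: qd; rewrite q0 mul0r; lra.
pose h x y := (x != y) && (#|U| <= q * codegree_in E U x y)%N.
have [|A AU UA|s [us szs hs]] := @greedy_clique V h q M U q0.
- by move=> x; rewrite /h eqxx.
- have A0 : (0 < #|A|)%N by move: UA U0; lia.
  apply: many_heavy_codegrees => //.
  have := offdiag_codegree_ge E3 d0 g0 g1 gu dense tight AU.
  have : #|U|%:R <= (q ^ M)%:R * #|A|%:R :> R by rewrite -natrM ler_nat.
  rewrite -(ler_nat R) 3!natrM [(_ ^ 2)%:R]natrX; move: small qd.
  have : 0 < #|U|%:R :> R by rewrite ltr0n.
  have : 0 < #|A|%:R :> R by rewrite ltr0n.
  have : 0 < q%:R :> R by rewrite ltr0n.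
  have : 0 <= (offdiag_codegree E U A)%:R :> R by [].
  move: (#|U|%:R : R) (#|A|%:R : R) (q%:R : R) ((q ^ M)%:R : R) ((offdiag_codegree E U A)%:R : R).
  clear - d0 g0 => u a k p c c0 k0 a0 u0 small kd ua lower.
  have k1 : g * u ^+ 3 <= g * u * (p * a) ^+ 2.
    rewrite (_ : g * u ^+ 3 = g * u * u ^+ 2); last by ring.
    have pa0 : 0 <= p * a := le_trans (ltW u0) ua.
    by apply: ler_wpM2l; rewrite ?mulr_ge0 ?ler_sqr ?nnegrE ?(ltW g0) ?(ltW u0).
  have k2 : 132 * g * p ^+ 2 * (u * a ^+ 2) <= d * (u * a ^+ 2).
    by apply: ler_wpM2r => //; rewrite mulr_ge0 ?sqr_ge0 ?(ltW u0).
  have k3 : d / 2 * (u * a ^+ 2) <= c by move: k1 k2 lower; rewrite exprMn; lra.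
  have k4 : k * (d / 2 * (u * a ^+ 2)) <= k * c by rewrite ler_wpM2l ?(ltW k0).
  have k5 : 4 * (u * a ^+ 2) <= k * d * (u * a ^+ 2).
    by apply: ler_wpM2r => //; rewrite mulr_ge0 ?sqr_ge0 ?(ltW u0).
  by move: k4 k5; lra.
exists s; split=> // x y /hs/andP[xy /leq_trans]; apply.
by rewrite leq_mul2l codegree_in_le ?orbT.
Qed.

Lemma bin3_le (R : realFieldType) (n : nat) : 'C(n, 3)%:R <= n%:R ^+ 3 / 6 :> R.
Proof.
have : ('C(n, 3) * 6 <= n ^ 3)%N.
  rewrite -[6%N]/(3`!)%N bin_ffact; do 3!case: n => [|n] //.
  rewrite /falling_factorial /ffact_rec /=; nia.
by rewrite -(ler_nat R) natrM natrX; lra.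
Qed.

Lemma bin3_ge (R : realFieldType) (n : nat) :
  n%:R ^+ 3 / 6 - n%:R ^+ 2 / 2 <= 'C(n, 3)%:R :> R.
Proof.
have : (n ^ 3 <= 'C(n, 3) * 6 + 3 * n ^ 2)%N.
  rewrite -[6%N]/(3`!)%N bin_ffact; case: n => [|[|[|n]]] //.
  rewrite /falling_factorial /ffact_rec /=; nia.
by rewrite -(ler_nat R) natrD [(n ^ 3)%:R]natrX 2!natrM [(n ^ 2)%:R]natrX; lra.
Qed.

(** * Vanishing of the uniform Turan density *)

Section PiUnif.
Variables (R : realType) (W : finType) (EF : {set {set W}}).

Definition attainable (d : R) : Prop :=
  0 <= d <= 1 /\ forall eta : R, 0 < eta -> forall n0 : nat,
    exists N : nat, (n0 <= N)%N /\ exists E : {set {set 'I_N}},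
      is3graph E /\ ~ has_copy EF E /\ unif_dense d eta E.

(** A positive value cannot be the default [0] of [sup], so it is a true supremum. *)
Lemma pi_unif_approx : 0 < pi_unif R EF -> pi_unif R EF <= 1 /\
  forall e : R, 0 < e -> exists2 d, attainable d &
    pi_unif R EF - e < d /\ ~ attainable (d + e).
Proof.
move=> pi0; pose A : set R := [set d | attainable d]%classic.
have piE : pi_unif R EF = sup A by [].
have supA : has_sup A.
  apply: contrapT => /sup_out; rewrite -piE => pi_0.
  by rewrite pi_0 ltxx in pi0.
split=> [|e e0].
  by rewrite piE; apply: ge_sup; [case: supA|move=> d [/andP[]]].
have [d Ad] := sup_adherent e0 supA; rewrite -piE => lt_d.
exists d => //; split=> // Ade; have := ub_le_sup (proj2 supA) Ade.
by rewrite -piE; lra.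
Qed.

(** A set [U] violating uniform density satisfies [eta * N ^ 3 <= d * 'C(#|U|, 3)], which forces [U]
    to be large. For [d > 1] the whole vertex set serves. *)
Lemma unattainable_witness (d : R) : 0 <= d -> ~ attainable d ->
  exists eta : R, [/\ 0 < eta, eta <= 1 & exists n0 : nat,
    forall N (E : {set {set 'I_N}}), (n0 <= N)%N -> is3graph E -> ~ has_copy EF E ->
    exists U : {set 'I_N}, eta * N%:R ^+ 3 <= #|U|%:R ^+ 3 /\
      #|edges_in E U|%:R <= d * 'C(#|U|, 3)%:R].
Proof.
move=> d0 not_att; have [d1|d1] := leP d 1; last first.
  exists 1; split=> //; exists 0%N => N E _ E3 _; exists setT.
  rewrite mul1r cardsT card_ord; split=> //.
  have : (#|edges_in E setT| <= 'C(N, 3))%N.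
    rewrite -[N in 'C(N, _)]card_ord -card_draws; apply: subset_leq_card.
    by apply/subsetP=> e; rewrite !inE => /andP[eE _]; have /forall_inP/(_ e eE) := E3.
  rewrite -(ler_nat R) => /le_trans; apply.
  by rewrite ler_peMl // ltW.
apply: contrapT => no; apply: not_att; split=> [|eta eta0 n0]; first by rewrite d0.
apply: contrapT => noN; apply: no; exists (Num.min eta 1).
split; rewrite ?lt_min ?eta0 ?ltr01 ?ge_min ?lexx ?orbT //.
exists n0 => N E n0N E3 nocopy; apply: contrapT => noU; apply: noN.
exists N; split=> //; exists E; do 2!split=> //; move=> U; rewrite leNgt.
apply/negP => sparse; apply: noU; exists U; rewrite card_ord in sparse.
have N0 : 0 <= N%:R ^+ 3 :> R by rewrite exprn_ge0.
have U0 : 0 <= #|U|%:R ^+ 3 :> R by rewrite exprn_ge0.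
have C0 : 0 <= 'C(#|U|, 3)%:R :> R by [].
have k1 : 0 <= eta * N%:R ^+ 3 by rewrite mulr_ge0 // ltW.
have k2 : d * 'C(#|U|, 3)%:R <= 'C(#|U|, 3)%:R by rewrite ler_piMl.
split; last first.
  by apply: ltW; apply: lt_le_trans sparse _; rewrite gerBl.
have e0 : 0 <= #|[set e in E | e \subset U]|%:R :> R by [].
have k3 : Num.min eta 1 * N%:R ^+ 3 <= eta * N%:R ^+ 3.
  by rewrite ler_wpM2r // ge_min lexx.
have := bin3_le R #|U|; lra.
Qed.

(** The constants are chosen in the order [q], [M], [g], [d], [eta], [N], each depending on the
    earlier ones. *)
Lemma pi_unif_le0 P r S : oriented_links EF P r S -> pi_unif R EF <= 0.
Proof.
move=> EFP; rewrite leNgt; apply/negP => pi0.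
have [pi1 approx] := pi_unif_approx pi0.
move: (pi_unif R EF) pi0 pi1 approx => pi pi0 pi1 approx.
(* This gives [q * d >= 4] once [d >= pi / 2]. *)
pose q := (Num.truncn (8 / pi)).+1.
have q_pi : 8 <= q%:R * pi.
  by rewrite -ler_pdivrMr //; apply/ltW/truncnS_gt.
have [M [N0 HMN]] := @oriented_links_copy #|W| q isT.
pose p : R := (q ^ M)%:R.
have p1 : 1 <= p ^+ 2 by rewrite exprn_ege1 // ler1n expn_gt0.
pose g := pi / (264 * p ^+ 2).
have pp0 : 0 < 264 * p ^+ 2 by lra.
have g0 : 0 < g by rewrite divr_gt0.
have gp : 132 * g * p ^+ 2 = pi / 2.
  by rewrite /g; field; rewrite -sqrf_eq0; apply/eqP=> p0; move: p1; rewrite p0; lra.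
have g_pi : g <= pi / 264.
  rewrite /g ler_pM2l // lef_pV2 ?posrE //; lra.
have g1 : g <= 1 by lra.
have gg0 : 0 < g ^+ 2 by rewrite exprn_gt0.
have gg : g ^+ 2 <= g by rewrite expr2 ger_pMr.
have [d [/andP[d0 d1] dense_att] [lt_d not_att]] := approx _ gg0.
have [||eta [eta0 eta1 [n0 witness]]] := @unattainable_witness (d + g ^+ 2); [lra|done|].
(* A set of size at least [K] is large enough for the embedding and for replacing binomials by
   cubes; [n2] ensures that the witness [U] has this size. *)
pose K := maxn N0 (Num.truncn (1 / g ^+ 2)).+1.
pose n2 := maxn n0 (Num.truncn (K%:R ^+ 3 / eta)).+1.
(* As [eta * N ^ 3 <= #|U| ^ 3], this tolerance costs half of [g ^ 2 * #|U| ^ 3]; the other half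
   absorbs the quadratic term of the binomial. *)
have eg0 : 0 < eta * g ^+ 2 / 2 by rewrite divr_gt0 // mulr_gt0.
have [N [n2N [E [E3 [nocopy dense]]]]] := dense_att _ eg0 n2.
have n0N : (n0 <= N)%N by apply: leq_trans n2N; rewrite leq_maxl.
have [U [NU tight]] := witness N E n0N E3 nocopy.
have KN : K%:R ^+ 3 <= eta * N%:R ^+ 3.
  have N1 : (1 <= N)%N by apply: leq_trans n2N; rewrite leq_max orbT.
  rewrite mulrC -ler_pdivrMr //; apply: (@le_trans _ _ N%:R); last first.
    by rewrite -natrX ler_nat -[leqLHS]expn1 leq_pexp2l.
  apply: (@le_trans _ _ n2%:R); last by rewrite ler_nat.
  apply: (@le_trans _ _ (Num.truncn (K%:R ^+ 3 / eta)).+1%:R).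
    exact/ltW/truncnS_gt.
  by rewrite ler_nat leq_maxr.
have KU : (K <= #|U|)%N.
  have := le_trans KN NU; rewrite -!natrX ler_nat leq_exp2r //.
have gu : 1 <= g ^+ 2 * #|U|%:R.
  rewrite mulrC -ler_pdivrMr //; apply: (@le_trans _ _ K%:R); last by rewrite ler_nat.
  apply: (@le_trans _ _ (Num.truncn (1 / g ^+ 2)).+1%:R).
    exact/ltW/truncnS_gt.
  by rewrite ler_nat leq_maxr.
have u0 : 0 <= #|U|%:R :> R by [].
have [|||||s [us szs hs]] := @locally_dense_clique R _ E U d g q M E3 d0 g0 g1.
- by apply: le_trans gu _; rewrite ler_wpM2r.
- move=> X XU; have := dense X; rewrite -/(edges_in E X) card_ord => denseX.
  have xu : #|X|%:R ^+ 2 <= #|U|%:R ^+ 2 :> R.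
    by rewrite ler_sqr ?nnegrE // ler_nat subset_leq_card.
  have k1 : #|U|%:R ^+ 2 <= g ^+ 2 * #|U|%:R ^+ 3.
    rewrite (_ : g ^+ 2 * _ = g ^+ 2 * #|U|%:R * #|U|%:R ^+ 2); last by ring.
    by rewrite ler_peMl // sqr_ge0.
  have k2 : eta * g ^+ 2 / 2 * N%:R ^+ 3 <= g ^+ 2 / 2 * #|U|%:R ^+ 3.
    rewrite (_ : eta * g ^+ 2 / 2 * _ = g ^+ 2 / 2 * (eta * N%:R ^+ 3)); last by ring.
    by rewrite ler_wpM2l // divr_ge0 // ltW.
  have k3 : d * (#|X|%:R ^+ 3 / 6 - #|X|%:R ^+ 2 / 2) <= d * 'C(#|X|, 3)%:R.
    by rewrite ler_wpM2l // bin3_ge.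
  have k4 : d * #|X|%:R ^+ 2 <= #|X|%:R ^+ 2 by rewrite ler_piMl // sqr_ge0.
  by lra.
- apply: le_trans tight _.
  have : (d + g ^+ 2) * 'C(#|U|, 3)%:R <= (d + g ^+ 2) * (#|U|%:R ^+ 3 / 6).
    by rewrite ler_wpM2l ?bin3_le //; lra.
  have : 0 <= g ^+ 2 * #|U|%:R ^+ 3 by rewrite mulr_ge0 ?exprn_ge0 // ltW.
  lra.
- have : q%:R * (pi / 2) <= q%:R * d by rewrite ler_wpM2l //; lra.
  lra.
- by rewrite -/p gp; lra.
apply: nocopy; apply: (HMN W EF P r S _ _ _ E U s) => //; first by rewrite szs.
by apply: leq_trans KU; rewrite leq_maxl.
Qed.

End PiUnif.

(** * The construction *)

Section TripartiteHypergraph.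
Variables (n : nat) (adj : 'I_n -> rel 'I_n).
Hypothesis adj_irr : forall b, irreflexive (adj b).

Definition link_edge (b x y : 'I_n) : {set 'I_n + 'I_n} := [set inl x; inl y; inr b].

Definition link_hypergraph : {set {set 'I_n + 'I_n}} :=
  [set e | [exists b, exists x, exists y, adj b x y && (e == link_edge b x y)]].

Lemma link_hypergraphP e : reflect
  (exists b x y, adj b x y /\ e = link_edge b x y) (e \in link_hypergraph).
Proof.
rewrite inE; apply: (iffP existsP) => [[b /existsP[x /existsP[y /andP[xy /eqP->]]]]|].
  by exists b, x, y.
case=> b [x [y [xy ->]]]; exists b; apply/existsP; exists x; apply/existsP; exists y.
by rewrite xy eqxx.
Qed.

Lemma adj_neq b x y : adj b x y -> x != y.
Proof. by apply: contraTneq => ->; rewrite adj_irr. Qed.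

Lemma is3graph_link_hypergraph : is3graph link_hypergraph.
Proof.
apply/forall_inP=> e /link_hypergraphP[b [x [y [xy ->]]]].
have xy' : (inl x : 'I_n + 'I_n) != inl y := adj_neq xy.
by rewrite /link_edge -setUA cardsU1 cards2 !inE negb_or xy'.
Qed.

Lemma link_hypergraph_parts e : e \in link_hypergraph ->
  #|e :&: partA n| = 2%N /\ #|e :&: partB n| = 1%N.
Proof.
case/link_hypergraphP=> b [x [y [xy ->]]].
have xy' : (inl x : 'I_n + 'I_n) != inl y := adj_neq xy.
have -> : link_edge b x y :&: partA n = [set inl x; inl y].
  by apply/setP=> -[z|z]; rewrite !inE ?andbT ?andbF ?orbF.
have -> : link_edge b x y :&: partB n = [set inr b].
  by apply/setP=> -[z|z]; rewrite !inE ?andbT ?andbF ?orbF.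
by rewrite cards2 xy' cards1.
Qed.

Lemma codeg_ll x y :
  (#|[set b | adj b x y]| <= codeg link_hypergraph [set inl x; inl y])%N.
Proof.
rewrite -(@card_imset _ _ (fun b => link_edge b x y)) => [|b b' /setP/(_ (inr b))].
  apply/subset_leq_card/subsetP=> _ /imsetP[b + ->]; rewrite inE => xy.
  rewrite inE subsetUl andbT; apply/link_hypergraphP; by exists b, x, y.
by rewrite !inE eqxx => /esym/eqP[].
Qed.

Lemma codeg_lr x b :
  (#|[set y | adj b x y]| <= codeg link_hypergraph [set inl x; inr b])%N.
Proof.
rewrite -(@card_in_imset _ _ (fun y => link_edge b x y)) => [|y y'].
  apply/subset_leq_card/subsetP=> _ /imsetP[y + ->]; rewrite inE => xy.
  rewrite inE; apply/andP; split; first by apply/link_hypergraphP; exists b, x, y.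
  by apply/subsetP=> z; rewrite !inE => /orP[] ->; rewrite ?orbT.
rewrite !inE => /adj_neq xy _ /setP/(_ (inl y)); rewrite !inE eqxx orbT /= orbF.
by rewrite /eq_op /= [y == x]eq_sym (negbTE xy) => /esym/eqP.
Qed.

End TripartiteHypergraph.

Lemma F2_cases (t : 'F_2) : (t == 0) || (t == 1).
Proof. by case: t => -[|[|]]. Qed.

Lemma F2_double (t : 'F_2) : t + t = 0.
Proof. by case/orP: (F2_cases t) => /eqP->; apply/val_inj. Qed.

Lemma F2_opp (t : 'F_2) : - t = t.
Proof. by apply/eqP; rewrite eq_sym -addr_eq0 F2_double. Qed.

(** * Block structure and links *)

Section LinkFamily.
Variables k r : nat.
Notation T := 'rV['F_2]_k.
Notation V := 'rV['F_2]_r.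
Notation X := (T * (V * 'F_2))%type.

Definition dot (u v : V) : 'F_2 := \sum_i u 0 i * v 0 i.
(** The coordinate [x.2.2] always has coefficient one, which balances the cut on every block;
    [b.2.2] exchanges the two sides. *)
Definition side (b x : X) : 'F_2 := dot b.2.1 x.2.1 + x.2.2 + b.2.2.
Definition cyclic_next (i j : T) : bool := enum_rank j == ((enum_rank i).+1 %% #|T|)%N :> nat.
Definition arc (b x y : X) : bool :=
  if b.1 == 0 then
    [&& side b x == 0, side b y == 1
      & cyclic_next x.1 y.1 || (x.1 == y.1) && (enum_rank x.2 < enum_rank y.2)%N]
  else y.1 == x.1 + b.1.
Definition adjacent (b x y : X) : bool := arc b x y || arc b y x.

Lemma rV_double (c : T) : c + c = 0.
Proof. by apply/rowP => i; rewrite !mxE F2_double. Qed.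

Lemma adjacent_irr b : irreflexive (adjacent b).
Proof.
move=> x; rewrite /adjacent orbb /arc; case: ifPn => [_|b0].
  by case: eqP => //= ->.
by apply: contraNF b0 => /eqP xb; rewrite -(inj_eq (addrI x.1)) addr0 -xb.
Qed.

Lemma adjacentC b x y : adjacent b x y = adjacent b y x.
Proof. by rewrite /adjacent orbC. Qed.

Lemma cardX : #|{: X}| = (#|T| * (#|V| * 2))%N.
Proof. by rewrite !card_prod card_Fp. Qed.

Lemma dotBr u v w : dot u (v - w) = dot u v - dot u w.
Proof. by rewrite /dot -sumrB; apply: eq_bigr => i _; rewrite !mxE mulrBr. Qed.

Lemma dotDl u u' v : dot (u + u') v = dot u v + dot u' v.
Proof. by rewrite /dot -big_split; apply: eq_bigr => i _; rewrite !mxE mulrDl. Qed.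

Lemma dot_delta i v : dot (delta_mx 0 i) v = v 0 i.
Proof.
rewrite /dot (bigD1 i) //= big1 => [|j ji]; rewrite mxE eqxx /=.
  by rewrite eqxx mul1r addr0.
by rewrite (negbTE ji) mul0r.
Qed.

(** If [w] has a nonzero coordinate [i], translation by the [i]-th unit vector maps the complement
    into the set; if [w = 0], then [t = 1]. *)
Lemma half_dot (w : V) (t : 'F_2) : (w, t) != 0 ->
  (#|V| <= 2 * #|[set u : V | (dot u w + t == 1)%R]|)%N.
Proof.
move=> wt; set A := [set u | _].
have [w0|/rV0Pn[i wi]] := eqVneq w 0.
  suff -> : A = setT by rewrite cardsT leq_pmull.
  apply/setP=> u; rewrite !inE /dot big1 ?add0r => [|j _]; last by rewrite w0 mxE mulr0.
  by case/orP: (F2_cases t) => // t0; case/negP: wt; rewrite w0 (eqP t0).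
have sub : [set u + delta_mx 0 i | u in ~: A] \subset A.
  apply/subsetP=> _ /imsetP[u uA ->]; move: uA; rewrite !inE dotDl dot_delta.
  have -> : w 0 i = 1 by case/orP: (F2_cases (w 0 i)) wi => /eqP-> //; rewrite eqxx.
  rewrite addrAC; case/orP: (F2_cases (dot u w + t)) => /eqP-> //.
have := subset_leq_card sub; rewrite card_imset; last exact: addIr.
by rewrite -(cardsC A) mul2n -addnn leq_add2l.
Qed.

(** Vertices in different blocks are joined by all [b] with [b.1] the difference of the blocks. In a
    common block, half of the vectors [u] separate them, and one choice of [b.2.2] directs the cut
    along the order. *)
Lemma pair_degree x y : x != y -> (#|V| * 2 <= 4 * #|[set b | adjacent b x y]|)%N.
Proof.
move=> xy; have [xy1|xy1] := eqVneq x.1 y.1; last first.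
  have : setX [set y.1 - x.1] setT \subset [set b | adjacent b x y].
    apply/subsetP=> -[c z]; rewrite !inE /= andbT => /eqP->.
    rewrite /adjacent /arc /= subr_eq0 eq_sym (negbTE xy1).
    by rewrite addrC subrK eqxx.
  move/subset_leq_card; rewrite cardsX cards1 cardsT card_prod card_Fp // mul1n => h.
  by apply: leq_trans h _; apply: leq_pmull.
wlog lt_xy : x y xy xy1 / (enum_rank x.2 < enum_rank y.2)%N => [wl|].
  have [lt|lt|eq_r] := ltngtP (enum_rank x.2) (enum_rank y.2).
  - exact: wl.
  - have := wl y x; rewrite eq_sym => /(_ xy (esym xy1) lt).
    rewrite (_ : [set b | adjacent b y x] = [set b | adjacent b x y]) //.
    by apply/setP=> b; rewrite !inE adjacentC.
  move/val_inj/enum_rank_inj: eq_r xy1 xy; case: x y => [x1 x2] [y1 y2] /= -> ->.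
  by rewrite eqxx.
case: x y xy xy1 lt_xy => [i [v1 t1]] [j [v2 t2]] /= + ij; rewrite -{j}ij => xy lt_xy.
have wt : (v2 - v1, t2 - t1) != 0.
  by apply: contra xy; rewrite xpair_eqE !subr_eq0 => /andP[/eqP-> /eqP->].
have := half_dot wt; set A := [set u | _].
pose f u : X := (0, (u, dot u v1 + t1)).
have : f @: A \subset [set b | adjacent b (i, (v1, t1)) (i, (v2, t2))].
  apply/subsetP=> _ /imsetP[u uA ->]; move: uA; rewrite !inE dotBr => /eqP u1.
  apply/orP; left; rewrite /arc /= (eqxx 0) /side /= F2_double !eqxx lt_xy orbT andbT /=.
  by rewrite -u1 !F2_opp; apply/eqP; ring.
move/subset_leq_card; rewrite card_imset => [AB VA|u u' [] //].
rewrite mulnC -[4%N]/(2 * 2)%N -mulnA leq_mul2l /=; apply: leq_trans VA _.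
by rewrite leq_mul2l.
Qed.

Lemma cyclic_succ (i : T) : exists j, cyclic_next i j.
Proof.
have T0 : (0 < #|T|)%N by apply/card_gt0P; exists i.
exists (enum_val (Ordinal (ltn_pmod (enum_rank i).+1 T0))).
by rewrite /cyclic_next enum_valK.
Qed.

Lemma cyclic_pred (j : T) : exists i, cyclic_next i j.
Proof.
have T0 : (0 < #|T|)%N by apply/card_gt0P; exists j.
exists (enum_val (Ordinal (ltn_pmod (enum_rank j + #|T|.-1) T0))).
rewrite /cyclic_next enum_valK /= -[(_ %% _)%N.+1]addn1 modnDml -addnA addn1 prednK //.
by rewrite modnDr modn_small.
Qed.

Lemma half_part (b : X) (j : T) (c : 'F_2) :
  (#|V| <= #|[set y : X | (y.1 == j) && (side b y == c)]|)%N.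
Proof.
pose f v : X := (j, (v, dot b.2.1 v + b.2.2 + c)).
have f_inj : injective f by move=> v v' [].
rewrite -cardsT -(card_imset _ f_inj); apply/subset_leq_card/subsetP=> _ /imsetP[v _ ->].
rewrite inE eqxx /side /=.
by rewrite [X in X == _](_ : _ = (dot b.2.1 v + dot b.2.1 v) + (b.2.2 + b.2.2) + c);
  [rewrite !F2_double !add0r | ring].
Qed.

(** For [b.1 = 0], a vertex on side [0] sees half of the next block and one on side [1] half of the
    previous block. The cyclic order leaves no first or last block without such a neighbour. *)
Lemma link_degree b x : (#|V| * 2 <= 2 * #|[set y | adjacent b x y]|)%N.
Proof.
have [b0|b0] := eqVneq b.1 0; last first.
  have : setX [set x.1 + b.1] setT \subset [set y | adjacent b x y].
    apply/subsetP=> -[c z]; rewrite !inE /= andbT => /eqP->.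
    by rewrite /adjacent /arc /= (negbTE b0) eqxx.
  move/subset_leq_card; rewrite cardsX cards1 cardsT card_prod card_Fp // mul1n => h.
  by apply: leq_trans h _; apply: leq_pmull.
rewrite mulnC leq_mul2l; case/orP: (F2_cases (side b x)) => sx.
  have [j xj] := cyclic_succ x.1; apply: leq_trans (half_part b j 1) _.
  apply/subset_leq_card/subsetP=> y; rewrite !inE => /andP[/eqP yj sy].
  by apply/orP; left; rewrite /arc b0 eqxx sx sy yj xj.
have [j xj] := cyclic_pred x.1; apply: leq_trans (half_part b j 0) _.
apply/subset_leq_card/subsetP=> y; rewrite !inE => /andP[/eqP yj sy].
by apply/orP; right; rewrite /arc b0 eqxx sx sy yj xj.
Qed.

(* Vertices avoiding the part [i0] are ordered by cutting the cyclic order there. *)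
Section Cut.
Variable i0 : T.

Definition cut_position (i : T) : nat :=
  ((enum_rank i + (#|T| - enum_rank i0)) %% #|T|)%N.

Definition cut_key (x : X) : nat :=
  (cut_position x.1 * #|{: V * 'F_2}| + enum_rank x.2)%N.

(** For [b.1 != 0] the blocks [i] and [i + b.1] are partners, and the one that comes first after
    cutting is declared the source. *)
Definition cut_source (b x : X) : bool :=
  if b.1 == 0 then side b x == 0 else (cut_position x.1 < cut_position (x.1 + b.1))%N.

Lemma cut_position_inj : injective cut_position.
Proof.
move=> i j /eqP; rewrite /cut_position eqn_modDr => /eqP.
by rewrite !modn_small // => /val_inj/enum_rank_inj.
Qed.

(** Only the step into [i0], which has position [0], wraps around. *)
Lemma cut_position_next i j : cyclic_next i j -> j != i0 ->
  cut_position j = (cut_position i).+1.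
Proof.
have T0 : (0 < #|T|)%N by apply/card_gt0P; exists i0.
move=> /eqP ij ji0.
have jE : cut_position j = ((cut_position i).+1 %% #|T|)%N.
  by rewrite /cut_position ij modnDml addSn -[(cut_position i).+1]addn1 /cut_position modnDml addn1.
have i0E : cut_position i0 = 0%N.
  by rewrite /cut_position subnKC ?modnn // ltnW.
have : (cut_position i < #|T|)%N by rewrite ltn_mod.
rewrite leq_eqVlt => /orP[/eqP full|lt]; last by rewrite jE modn_small.
by case/eqP: ji0; apply: cut_position_inj; rewrite jE i0E full modnn.
Qed.

Lemma cut_key_lt (x y : X) : (cut_position x.1 < cut_position y.1)%N ->
  (cut_key x < cut_key y)%N.
Proof.
move=> lt; rewrite /cut_key; have := ltn_ord (enum_rank x.2).
move: (nat_of_ord (enum_rank x.2)) (nat_of_ord (enum_rank y.2)) => a c.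
move: #|_| lt => h; move: (cut_position _) (cut_position _) => p p'; nia.
Qed.

Lemma cut_key_inj : injective cut_key.
Proof.
move=> x y xy; have [lt|lt|/cut_position_inj xy1] :=
  ltngtP (cut_position x.1) (cut_position y.1).
- by have := cut_key_lt lt; rewrite xy ltnn.
- by have := cut_key_lt lt; rewrite xy ltnn.
move/eqP: xy; rewrite /cut_key xy1 eqn_add2l => /eqP/val_inj/enum_rank_inj.
by move: xy1; case: x y => [? ?] [? ?] /= -> ->.
Qed.

Lemma arc_cut_key b x y : b.1 = 0 -> y.1 != i0 -> arc b x y -> (cut_key x < cut_key y)%N.
Proof.
move=> b0 yi0; rewrite /arc b0 eqxx => /and3P[_ _ /orP[xy|/andP[/eqP xy lt]]].
  by apply: cut_key_lt; rewrite (cut_position_next xy yi0).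
by rewrite /cut_key xy ltn_add2l.
Qed.

Lemma adjacent_cut b x y : x.1 != i0 -> y.1 != i0 -> adjacent b x y ->
  (cut_key x < cut_key y)%N -> cut_source b x && ~~ cut_source b y.
Proof.
move=> xi0 yi0 xy lt; rewrite /cut_source; have [b0|b0] := eqVneq b.1 0.
  case/orP: xy => xy; last by have := arc_cut_key b0 xi0 xy; rewrite ltnNge ltnW.
  by move: xy; rewrite /arc b0 eqxx => /and3P[-> /eqP->].
have shift (i j : T) : i = j + b.1 -> j = i + b.1.
  by move=> ->; rewrite -addrA rV_double addr0.
have yE : y.1 = x.1 + b.1.
  by case/orP: xy; rewrite /arc (negbTE b0) => /eqP // /shift.
rewrite -yE -(shift _ _ yE).
have [lt'|lt'|/cut_position_inj xy1] := ltngtP (cut_position x.1) (cut_position y.1).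
- by [].
- by have := cut_key_lt lt'; rewrite ltnNge ltnW.
by case/eqP: b0; apply: (addrI x.1); rewrite addr0 -yE.
Qed.

End Cut.

End LinkFamily.

(** Fewer than [2 ^ k] vertices miss some block [i0]; [cut_key] and [cut_source] for this block,
    pulled back along the copy, orient its links. *)
Lemma oriented_links_adjacent (k r m : nat) (EF : {set {set 'I_m}}) :
  let X := ('rV['F_2]_k * ('rV['F_2]_r * 'F_2))%type in
  let adj (b x y : 'I_#|{: X}|) := adjacent (enum_val b) (enum_val x) (enum_val y) in
  (m < 2 ^ k)%N -> has_copy EF (link_hypergraph adj) ->
  exists P r S, oriented_links EF P r S.
Proof.
move=> X adj mk [g [g_inj gE]].
pose val w : X := match g w with inl a => enum_val a | inr b => enum_val b end.
have [i0 i0P] : exists i0, forall w, (val w).1 != i0.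
  have : (#|[set (val w).1 | w in 'I_m]| < #|[set: 'rV['F_2]_k]|)%N.
    rewrite cardsT card_mx card_Fp // mul1n; apply: leq_ltn_trans mk.
    by rewrite (leq_trans (leq_imset_card _ _)) // card_ord.
  rewrite ltnNge => /negP not_full; apply: contrapT => no; apply: not_full.
  apply/subset_leq_card/subsetP=> i _; apply: contrapT => /negP iP; apply: no.
  by exists i => w; apply: contraNneq iP => <-; apply: imset_f.
exists (fun w => if g w is inl _ then true else false), (fun w => cut_key i0 (val w)).
exists (fun b w => cut_source i0 (val b) (val w)); split=> [w w'|e eE].
  rewrite /in_mem /= /val; case gw : (g w) => [a|//] _; case gw' : (g w') => [a'|//] _.
  by move/cut_key_inj/enum_val_inj=> aa'; apply: g_inj; rewrite gw gw' aa'.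
have /link_hypergraphP[b [x [y [xy ge]]]] := gE e eE.
have pre z : z \in link_edge b x y -> exists w, g w = z.
  by rewrite -ge => /imsetP[w we ->]; exists w.
have [w1 gw1] : exists w, g w = inl x by apply: pre; rewrite !inE eqxx.
have [w2 gw2] : exists w, g w = inl y by apply: pre; rewrite !inE eqxx orbT.
have [w3 gw3] : exists w, g w = inr b by apply: pre; rewrite !inE eqxx orbT.
have e_def : e = [set w1; w2; w3].
  by apply: (imset_inj g_inj); rewrite ge !imsetU !imset_set1 gw1 gw2 gw3.
have v1 : val w1 = enum_val x by rewrite /val gw1.
have v2 : val w2 = enum_val y by rewrite /val gw2.
have v3 : val w3 = enum_val b by rewrite /val gw3.
have xy12 : adjacent (val w3) (val w1) (val w2) by rewrite v1 v2 v3.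
have xy21 : adjacent (val w3) (val w2) (val w1) by rewrite adjacentC.
have [lt|lt|/cut_key_inj eq12] := ltngtP (cut_key i0 (val w1)) (cut_key i0 (val w2)).
- have /andP[S1 S2] := adjacent_cut (i0P w1) (i0P w2) xy12 lt.
  by exists w1, w2, w3; split=> //; rewrite gw1 gw2 gw3.
- have /andP[S1 S2] := adjacent_cut (i0P w2) (i0P w1) xy21 lt.
  by exists w2, w1, w3; split=> //; rewrite ?gw1 ?gw2 ?gw3 // e_def [_ :|: [set w2]]setUC.
by rewrite eq12 adjacent_irr in xy12.
Qed.

(** * Choice of parameters and verification of the conditions *)

Theorem theorem3p2 (R : realType) :
  forall k : nat, (0 < k)%N ->
  exists eps : R, 0 < eps /\
    forall m0 : nat, exists n : nat, (m0 <= n)%N /\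
      exists E : {set {set ('I_n + 'I_n)%type}},
        [/\ is3graph E,
            (forall e, e \in E -> #|e :&: partA n| = 2%N /\ #|e :&: partB n| = 1%N),
            (forall a1 a2 : 'I_n, a1 != a2 ->
               eps * n%:R <= (codeg E [set inl a1; inl a2])%:R),
            (forall a b : 'I_n, eps * n%:R <= (codeg E [set inl a; inr b])%:R)
          & (forall (m : nat) (EF : {set {set 'I_m}}), (m <= k)%N ->
               is3graph EF -> 0 < pi_unif R EF -> ~ has_copy EF E)].
Proof.
(* All codegrees are at least [#|V| * 2 / 4], while [n = 2 ^ k * (#|V| * 2)]. *)
move=> k _; pose c := (4 * 2 ^ k)%N.
have c0 : 0 < c%:R :> R by rewrite ltr0n muln_gt0 expn_gt0.
exists c%:R^-1; split; first by rewrite invr_gt0.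
(* The required lower bound on [n] itself serves as the dimension [r], since [n >= 2 ^ r > r]. *)
move=> r; pose X := ('rV['F_2]_k * ('rV['F_2]_r * 'F_2))%type.
pose V := 'rV['F_2]_r.
have cX : #|{: X}| = (2 ^ k * (#|{: V}| * 2))%N.
  by rewrite cardX card_mx card_Fp // mul1n.
exists #|{: X}|; split.
  have : (r < #|{: V}|)%N by rewrite card_mx card_Fp // mul1n ltn_expl.
  have : (0 < 2 ^ k)%N by rewrite expn_gt0.
  by rewrite cX; nia.
pose adj (b x y : 'I_#|{: X}|) := adjacent (enum_val b) (enum_val x) (enum_val y).
have adj_irr b : irreflexive (adj b) by move=> x; apply: adjacent_irr.
have count (Q : pred X) : #|[set i : 'I_#|{: X}| | Q (enum_val i)]| = #|[set x | Q x]|.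
  rewrite -(card_imset _ enum_val_inj); apply: eq_card => x; rewrite [RHS]inE.
  apply/imsetP/idP => [[i]|Qx]; first by rewrite inE => Qi ->.
  by exists (enum_rank x); rewrite ?inE enum_rankK.
have degree (N M : nat) : (#|{: V}| * 2 <= 4 * N)%N -> (N <= M)%N ->
    c%:R^-1 * #|{: X}|%:R <= M%:R :> R.
  move=> VN NM; rewrite mulrC ler_pdivrMr // -natrM ler_nat cX /c.
  rewrite [(M * _)%N]mulnC mulnAC mulnC leq_mul2r; apply/orP; right.
  by apply: leq_trans VN _; rewrite leq_mul2l NM orbT.
exists (link_hypergraph adj); split.
- exact: is3graph_link_hypergraph.
- exact: link_hypergraph_parts.
- move=> x y xy; apply: degree (codeg_ll adj x y).
  rewrite (count (fun b => adjacent b (enum_val x) (enum_val y))); apply: pair_degree.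
  by apply: contra xy => /eqP/enum_val_inj->.
- move=> x b; apply: degree (codeg_lr adj_irr x b).
  rewrite (count (fun y => adjacent (enum_val b) (enum_val x) y)).
  by apply: leq_trans (link_degree _ _) _; apply: leq_mul.
move=> m EF mk EF3 pi0 copy.
have m_lt : (m < 2 ^ k)%N by apply: leq_ltn_trans mk (ltn_expl k _).
have [P [rk [S EFP]]] := oriented_links_adjacent m_lt copy.
by have := pi_unif_le0 R EFP; rewrite leNgt pi0.
Qed.
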